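(* Let $(X,Y,\langle\cdot,\cdot\rangle)$ be an asymmetric dual pair, let $A\subseteq X$ and $B\subseteq Y$, and let $\mathcal N$ be a neighbourhood basis of the origin in $(X,\sigma(X,Y))$. Then $${}^\circ(A^\circ)=\mathrm{cl}_{\overline{\sigma}(X,Y)}\,\mathrm{conv}\,[A\cup\{0\}]=\bigcap_{N\in\mathcal N}\big[N+\mathrm{conv}\,(A\cup\{0\})\big]$$ and $$({}^\circ B)^\circ=\mathrm{cl}_{\sigma(Y,X)}\,\mathrm{conv}\,[B\cup\{0\}].$$
   Context: All vector spaces and cones are over the reals; a cone is a commutative monoid $(Y,+,0)$ with a scalar multiplication by nonnegative reals satisfying the usual vector space axioms. An asymmetric dual pair $(X,Y,\langle\cdot,\cdot\rangle)$ consists of a vector space $X$, a cone $Y$ and a map $\langle\cdot,\cdot\rangle:X\times Y\to\mathbb R$ that is bilinear (with respect to nonnegative scalars in the second variable) and nondegenerate: $\langle x,\cdot\rangle=0$ implies $x=0$, and $\langle\cdot,y\rangle=\langle\cdot,z\rangle$ implies $y=z$. An asymmetric seminorm on a vector space or cone $Z$ is a function $p:Z\to[0,\infty)$ with $p(rx)=rp(x)$ for $r\ge 0$ and $p(x+y)\le p(x)+p(y)$. A family $\mathcal P$ of asymmetric seminorms on $Z$ induces the topology with basis the sets $\{y\in Z:\exists\Delta\in Z,\ y=x+\Delta\text{ and }p(\Delta)<\epsilon\ \forall p\in F\}$, for $x\in Z$, $\epsilon>0$, $F\subseteq\mathcal P$ finite. $\sigma(X,Y)$ is the topology on $X$ induced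 by the asymmetric seminorms $p_y(x)=\max\{\langle x,y\rangle,0\}$, $y\in Y$. $\overline\sigma(X,Y)$ is the conjugate topology on $X$, induced by $x\mapsto p_y(-x)$, $y\in Y$. $\sigma(Y,X)$ is the topology on $Y$ of pointwise convergence on $X$: $y_\alpha\to y$ iff $\langle x,y_\alpha\rangle\to\langle x,y\rangle$ for all $x\in X$. For $A\subseteq X$ the polar is $A^\circ=\{y\in Y:\langle x,y\rangle\le 1\ \forall x\in A\}$; for $B\subseteq Y$ the prepolar is ${}^\circ B=\{x\in X:\langle x,y\rangle\le1\ \forall y\in B\}$. $\mathrm{conv}$ denotes the convex hull. *)

(* Defs.v *)
From HB Require Import structures.
From mathcomp Require Import all_boot all_order all_algebra.
From mathcomp Require Import all_classical all_reals all_analysis.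

Set Implicit Arguments.
Unset Strict Implicit.
Unset Printing Implicit Defensive.

Import Order.TTheory GRing.Theory Num.Theory.
Import numFieldNormedType.Exports.

Local Open Scope classical_set_scope.
Local Open Scope ring_scope.

Section NonnegativeReals.
Context (R : realType).

Record nneg_real := NNegReal {
  nneg_val :> R;
  nneg_valP : nneg_val \is Num.nneg }.

HB.instance Definition _ := [isSub for nneg_val].
HB.instance Definition _ := [Choice of nneg_real by <:].
HB.instance Definition _ := [SubChoice_isSubComNzSemiRing of nneg_real by <:].

Lemma nneg_val_ge0 (r : nneg_real) : 0 <= (r : R).
Proof. by case: r => r /=; rewrite nnegrE. Qed.

End NonnegativeReals.

(* The semimodule axioms also contain 0 *: y = 0; without it a "scalar
   multiplication" on a non-cancellative monoid could send 0 *: y to another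
   idempotent. *)
Notation coneType R := (lSemiModType (nneg_real R)).

(* A real vector space seen as a cone, by restriction of the scalars. *)
Definition cone_of (R : realType) (X : lmodType R) : Type := X.

Section ConeOf.
Context (R : realType) (X : lmodType R).

HB.instance Definition _ := GRing.Zmodule.on (cone_of X).

Definition cone_of_scale (r : nneg_real R) (x : cone_of X) : cone_of X :=
  ((r : R) *: (x : X) : X).

Let scaleA a b v : cone_of_scale a (cone_of_scale b v) = cone_of_scale (a * b) v.
Proof. by rewrite /cone_of_scale scalerA. Qed.

Let scale0 v : cone_of_scale 0 v = 0.
Proof. by rewrite /cone_of_scale scale0r. Qed.

Let scale1 : left_id 1 cone_of_scale.
Proof. by move=> v; rewrite /cone_of_scale scale1r. Qed.

Let scaleDr : right_distributive cone_of_scale +%R.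
Proof. by move=> a u v; rewrite /cone_of_scale scalerDr. Qed.

Let scaleDl v : {morph cone_of_scale^~ v : a b / a + b}.
Proof. by move=> a b; rewrite /cone_of_scale scalerDl. Qed.

HB.instance Definition _ := GRing.Nmodule_isLSemiModule.Build (nneg_real R)
  (cone_of X) scaleA scale0 scale1 scaleDr scaleDl.

End ConeOf.

Section ConvexHull.
Context (R : realType) (Z : coneType R).

Definition convex_in_cone (C : set Z) :=
  forall (s t : nneg_real R) (x y : Z),
    s + t = 1 -> C x -> C y -> C (s *: x + t *: y).

Definition conv_hull (A : set Z) : set Z := smallest convex_in_cone A.

End ConvexHull.

Lemma convex_in_cone_of (R : realType) (X : lmodType R) (C : set X) :
  convex_in_cone (C : set (cone_of X)) <-> convex_set C.
Proof.
split=> [cC x y l|cC s t x y st Cx Cy].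
  rewrite !inE => Cx Cy.
  have l0 : l%:num \is Num.nneg by rewrite nnegrE.
  have l1 : 1 - l%:num \is Num.nneg by rewrite nnegrE subr_ge0.
  apply: (cC (NNegReal l0) (NNegReal l1) x y _ Cx Cy).
  by apply: val_inj => /=; rewrite addrC subrK.
have stR : (s : R) + (t : R) = 1 := congr1 val st.
have s1 : (s : R) <= 1 by rewrite -stR lerDl nneg_val_ge0.
have tE : (t : R) = 1 - (s : R) by rewrite -stR [_ + nneg_val t]addrC addrK.
have := cC x y (Itv01 (nneg_val_ge0 s) s1); rewrite !inE => /(_ Cx Cy).
by rewrite /GRing.scale /= /cone_of_scale tE.
Qed.

Section AsymmetricSeminorms.
Context (R : realType) (Z : coneType R).

Record asym_seminorm := AsymSeminorm {
  asn_val :> Z -> R;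
  asn_ge0 : forall x, 0 <= asn_val x;
  asnZ : forall (r : nneg_real R) x, asn_val (r *: x) = (r : R) * asn_val x;
  asnD : forall x y, asn_val (x + y) <= asn_val x + asn_val y }.

HB.instance Definition _ := gen_eqMixin asym_seminorm.
HB.instance Definition _ := gen_choiceMixin asym_seminorm.

Definition asym_ball (F : set asym_seminorm) (x : Z) (e : R) : set Z :=
  [set y | exists D : Z, y = x + D /\ forall p, F p -> p D < e].

Definition asym_base (P : set asym_seminorm) : set (set Z) :=
  [set U | exists (F : set asym_seminorm) (x : Z) (e : R),
    [/\ F `<=` P, finite_set F, 0 < e & U = asym_ball F x e]].

Definition asym_topology (P : set asym_seminorm) : Type := Z.

End AsymmetricSeminorms.

Section AsymTopology.
Context (R : realType) (Z : coneType R) (P : set (asym_seminorm Z)).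

HB.instance Definition _ := GRing.LSemiModule.on (asym_topology P).

Lemma asn0 (p : asym_seminorm Z) : p 0 = 0.
Proof. by rewrite -(scale0r (0 : Z)) asnZ mul0r. Qed.

Let base_cover : \bigcup_(U in asym_base P) U = [set: asym_topology P].
Proof.
rewrite -subTset => x _; exists (asym_ball set0 (x : Z) 1).
  by exists set0, (x : Z), 1; split => //; exact: ltr01.
by exists 0; split => //; rewrite addr0.
Qed.

Lemma asym_ball_in (F : set (asym_seminorm Z)) (x y : Z) (e : R) :
  finite_set F -> asym_ball F x e y ->
  exists2 e', 0 < e' & asym_ball F y e' `<=` asym_ball F x e.
Proof.
move=> Ffin [D [-> FD]].
have [e' e'0 he'] : exists2 e', 0 < e' & forall p, F p -> p D + e' <= e.
  move: Ffin => /finite_seqP[s Fs]; rewrite {}Fs in FD *.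
  elim: s FD => [_|p s ih FD]; first by exists 1.
  have [|e1 e10 h1] := ih; first by move=> q qs; apply: FD; rewrite /= inE qs orbT.
  have pDe : p D < e by apply: FD; rewrite /= inE eqxx.
  exists (Num.min e1 (e - p D)); first by rewrite lt_min e10 subr_gt0.
  move=> q; rewrite /= inE => /orP[/eqP ->|qs].
    by rewrite addrC -lerBrDr ge_min lexx orbT.
  by apply: le_trans (h1 _ qs); rewrite lerD2l ge_min lexx.
exists e' => // _ [E [-> FE]]; exists (D + E); split; first by rewrite addrA.
move=> p Fp; apply: le_lt_trans (asnD _ _ _) _.
by apply: lt_le_trans (he' _ Fp); rewrite ltrD2l FE.
Qed.

Let base_join (U V : set Z) (t : asym_topology P) :
  asym_base P U -> asym_base P V -> U t -> V t ->
  exists W, [/\ asym_base P W, W t & W `<=` U `&` V].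
Proof.
move=> [F [x [e [FP Ffin e0 ->]]]] [G [y [f [GP Gfin f0 ->]]]] Ut Vt.
have [e1 e10 He] := asym_ball_in Ffin Ut.
have [f1 f10 Hf] := asym_ball_in Gfin Vt.
have m0 : 0 < Num.min e1 f1 by rewrite lt_min e10.
exists (asym_ball (F `|` G) (t : Z) (Num.min e1 f1)); split.
- exists (F `|` G), (t : Z), (Num.min e1 f1); split => //.
    by rewrite subUset.
  by rewrite finite_setU.
- by exists 0; split => [|p _]; rewrite ?addr0// asn0.
- move=> z [D [-> FGD]]; split; [apply: He|apply: Hf]; exists D; split => // p Fp.
    by apply: lt_le_trans (FGD p (or_introl Fp)) _; rewrite ge_min lexx.
  by apply: lt_le_trans (FGD p (or_intror Fp)) _; rewrite ge_min lexx orbT.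
Qed.

HB.instance Definition _ :=
  isBaseTopological.Build (asym_topology P) base_cover base_join.

End AsymTopology.

Record asym_dual_pair (R : realType) (X : lmodType R) (Y : coneType R) :=
  AsymDualPair {
    pairing :> X -> Y -> R;
    pairingDl : forall x x' y, pairing (x + x') y = pairing x y + pairing x' y;
    pairingZl : forall (r : R) x y, pairing (r *: x) y = r * pairing x y;
    pairingDr : forall x y y', pairing x (y + y') = pairing x y + pairing x y';
    pairingZr : forall (r : nneg_real R) x y,
      pairing x (r *: y) = (r : R) * pairing x y;
    pairing_nondegl : forall x, (forall y, pairing x y = 0) -> x = 0;
    pairing_nondegr : forall y z,
      (forall x, pairing x y = pairing x z) -> y = z }.

Section ConjugateSeminorm.
Context (R : realType) (X : lmodType R) (p : asym_seminorm (cone_of X)).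

Let q (x : cone_of X) : R := p (- x).

Let q_ge0 x : 0 <= q x. Proof. exact: asn_ge0. Qed.

Let qZ (r : nneg_real R) x : q (r *: x) = (r : R) * q x.
Proof. by rewrite /q -asnZ; congr (asn_val p _); rewrite -[LHS]scalerN. Qed.

Let qD x y : q (x + y) <= q x + q y.
Proof. by rewrite /q opprD asnD. Qed.

Definition conj_seminorm := AsymSeminorm q_ge0 qZ qD.

End ConjugateSeminorm.

Section DualPairTopologies.
Context (R : realType) (X : lmodType R) (Y : coneType R).
Variable d : asym_dual_pair X Y.

Section PairingSeminorm.
Variable y : Y.

Let p (x : cone_of X) : R := Num.max (d x y) 0.

Let p_ge0 x : 0 <= p x. Proof. by rewrite le_max lexx orbT. Qed.

Let pZ (r : nneg_real R) x : p (r *: x) = (r : R) * p x.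
Proof. by rewrite /p maxr_pMr ?nneg_val_ge0// mulr0 -pairingZl. Qed.

Let pD x x' : p (x + x') <= p x + p x'.
Proof.
rewrite ge_max addr_ge0 ?p_ge0// andbT /p pairingDl.
by apply: lerD; rewrite le_max lexx.
Qed.

Definition pairing_seminorm := AsymSeminorm p_ge0 pZ pD.

End PairingSeminorm.

Definition sigma_XY := asym_topology (range pairing_seminorm).

Definition sigma_conj_XY :=
  asym_topology (range (fun y => conj_seminorm (pairing_seminorm y))).

Definition sigma_YX :=
  initial_topology (fun y : Y => (fun x => d x y) : {ptws X -> R}).

HB.instance Definition _ := GRing.LSemiModule.on sigma_XY.
HB.instance Definition _ := Topological.on sigma_XY.
HB.instance Definition _ := Topological.on sigma_conj_XY.
HB.instance Definition _ := Topological.on sigma_YX.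

Definition polar (A : set X) : set Y :=
  [set y | forall x, A x -> d x y <= 1].

Definition prepolar (B : set Y) : set X :=
  [set x | forall y, B y -> d x y <= 1].

End DualPairTopologies.

Definition nbhs_basis (T : topologicalType) (x : T) (N : set (set T)) :=
  N `<=` nbhs x /\ forall U, nbhs x U -> exists2 V, N V & V `<=` U.

(* Main.v *)
Require Import Defs.
From mathcomp Require Import all_boot all_order all_algebra.
From mathcomp Require Import all_classical all_reals all_analysis.
From mathcomp Require Import ring lra.

Set Implicit Arguments.
Unset Strict Implicit.
Unset Printing Implicit Defensive.

Import Order.TTheory GRing.Theory Num.Theory.
Import numFieldNormedType.Exports.

Local Open Scope classical_set_scope.
Local Open Scope ring_scope.

(** Both bipolar formulas are one statement about a bilinear map [phi] from
two cones [W] and [Z] to the reals, in which [Z] is [X] or [Y] and [W] is the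
other one: a point [z] satisfies every inequality [phi w z <= 1] that holds on
a set [A] if and only if, for finitely many [w] and every [e > 0], some [c] in
the convex hull [C] of [A] and [0] has [phi w z - phi w c < e] for all these
[w] ([bipolar_conv_hull0]).

Such approximation is what closure means in both topologies. For the conjugate
topology of [X] it is the definition of a neighbourhood
([closure_sigma_conj_XY]); reading [x - c] as an element of a neighbourhood of
[0] for [sigma_XY] gives the intersection formula as well. On [Y] the
neighbourhoods are two-sided, but there the functionals [w] range over the
vector space [X], so that [w] may be replaced by [- w] ([closure_sigma_YX]).

In the approximation statement one direction is immediate. For the other,
suppose that the approximation fails for [w_1], ..., [w_n] and [e]: at every
point [c] of [C] one of the functions [phi w_i z - phi w_i c - e] is
nonnegative. These functions of [c] are affine, and an alternative of
Fan-Glicksberg-Hoffman type ([convex_alternative]) yields a nonzero combination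
with nonnegative coefficients that is nonnegative on all of [C]. It has the
form [phi w z - phi w c - m] with [m > 0] and [w] in the cone [W]; a positive
multiple of [w] is at most [1] on [C] and exceeds [1] at [z]. Since only
nonnegative coefficients occur, the combination makes sense in a cone. The
alternative is proved by induction on the number of functions, the case of two
functions being an inequality between slopes. *)

(** * An alternative for finitely many convex functions *)

Section Alternative.
Context (R : realType) (Z : coneType R).

Definition convex_fun (f : Z -> R) := forall (s t : nneg_real R) (x y : Z),
  s + t = 1 -> f (s *: x + t *: y) <= (s : R) * f x + (t : R) * f y.

Lemma convex_conv_hull (A : set Z) : convex_in_cone (conv_hull A).
Proof.
move=> s t x y st Ax Ay M [cM AM].
exact: cM st (Ax M (conj cM AM)) (Ay M (conj cM AM)).
Qed.

Lemma convex_sublevel (C : set Z) (f : Z -> R) : convex_in_cone C ->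
  convex_fun f -> convex_in_cone (C `&` [set z | f z < 0]).
Proof.
move=> cC cf s t x y st [Cx fx] [Cy fy]; split; first exact: cC.
apply: le_lt_trans (cf _ _ _ _ st) _.
have stR : (s : R) + (t : R) = 1 := congr1 val st.
have s0 := nneg_val_ge0 s; have t0 := nneg_val_ge0 t.
have [s1|s1] := eqVneq (s : R) 0.
  by move: stR; rewrite s1 add0r mul0r add0r => ->; rewrite mul1r.
move: fx fy => /= fx fy.
have s2 : 0 < (s : R) by rewrite lt_neqAle eq_sym s1.
by have := mulr_ge0_le0 t0 (ltW fy); nra.
Qed.

(** The ratio [g / - f] on [f < 0] dominates [- g / f] on [f > 0]: otherwise
some point of the segment from [a] to [b] makes both [f] and [g] negative. The
inequality is kept free of quotients so that it covers [f a = 0]. *)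
Lemma cross_slopes (C : set Z) (f g : Z -> R) (a b : Z) : convex_in_cone C ->
  convex_fun f -> convex_fun g ->
  (forall z, C z -> f z < 0 -> 0 <= g z) ->
  C a -> C b -> 0 <= f a -> f b < 0 -> g a * f b <= g b * f a.
Proof.
move=> cC cf cg fg Ca Cb fa fb; rewrite leNgt; apply/negP => ba.
have gb := fg b Cb fb.
have ga : g a < 0 by nra.
(* The weight [r] of [a] against a unit weight of [b] must satisfy
   r * f a < - f b and g b < r * - g a. *)
pose e := (g a * f b - g b * f a) / (f a + 1).
have e0 : 0 < e by rewrite divr_gt0 ?subr_gt0 ?ltr_wpDl.
have eE : e * (f a + 1) = g a * f b - g b * f a by rewrite mulfVK//; lra.
pose r := (g b + e) / - g a.
have r0 : 0 < r by rewrite divr_gt0 ?oppr_gt0 ?ltr_wpDl.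
have rE : r * g a = - (g b + e).
  by rewrite -[LHS]opprK -mulrN mulfVK// oppr_eq0 lt_eqF.
have rf : r * f a + f b < 0.
  have : 0 < (r * f a + f b) * g a.
    have -> : (r * f a + f b) * g a = (r * g a) * f a + f b * g a by ring.
    by rewrite rE; lra.
  nra.
have rg : r * g a + g b < 0 by rewrite rE; lra.
have r1 : 0 < r + 1 by lra.
have s0 : r / (r + 1) \is Num.nneg by rewrite nnegrE divr_ge0// ltW.
have t0 : (r + 1)^-1 \is Num.nneg by rewrite nnegrE invr_ge0 ltW.
pose s := NNegReal s0; pose t := NNegReal t0.
have st : s + t = 1.
  by apply: val_inj => /=; rewrite -[X in _ + X]mul1r -mulrDl divff// gt_eqF.
have mix (h : Z -> R) : convex_fun h -> r * h a + h b < 0 ->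
    h (s *: a + t *: b) < 0.
  move=> ch hab; apply: le_lt_trans (ch _ _ _ _ st) _ => /=.
  have -> : r / (r + 1) * h a + (r + 1)^-1 * h b = (r * h a + h b) / (r + 1).
    by rewrite [RHS]mulrDl; ring.
  by rewrite ltr_pdivrMr// mul0r.
have := fg _ (cC _ _ _ _ st Ca Cb) (mix f cf rf).
by rewrite leNgt (mix g cg rg).
Qed.

(** Two functions with no common negative point are combined into one that is
nonnegative. The infimum of [g / - f] over [f < 0] is the largest multiplier
that these points allow, and by [cross_slopes] it is large enough for the
others. *)
Lemma convex_multiplier (C : set Z) (f g : Z -> R) : convex_in_cone C ->
  convex_fun f -> convex_fun g ->
  (exists2 z, C z & f z < 0) -> (forall z, C z -> f z < 0 -> 0 <= g z) ->
  exists2 t : R, 0 <= t & forall z, C z -> 0 <= g z + t * f z.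
Proof.
move=> cC cf cg [b Cb fb] fg.
pose S := [set g c / - f c | c in C `&` [set c | f c < 0]].
have Sn0 : S !=set0 by exists (g b / - f b); exists b.
have lbS0 : lbound S 0.
  by move=> _ [c [Cc fc] <-]; rewrite divr_ge0 ?fg// oppr_ge0 ltW.
exists (inf S); first exact: lb_le_inf.
move=> z Cz; have [fz|fz|fz] := ltgtP (f z) 0.
- have : inf S <= g z / - f z.
    by apply: ge_inf; [exists 0|exists z].
  by rewrite ler_pdivlMr ?oppr_gt0//; lra.
- have : - g z / f z <= inf S.
    apply: lb_le_inf => // _ [c [Cc fc] <-].
    rewrite ler_pdivlMr ?oppr_gt0// mulrAC ler_pdivrMr//.
    by have := cross_slopes cC cf cg fg Cz Cc (ltW fz) fc; lra.
  by rewrite ler_pdivrMr//; lra.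
- have : 0 <= f z by rewrite fz.
  move=> /(cross_slopes cC cf cg fg Cz Cb)/(_ fb); rewrite fz mulr0 mulr0 addr0.
  by nra.
Qed.

(** The family [G] records the form of the functions, which combination has to
preserve (below, an affine function given by some [w] and a positive constant).
One coefficient is always [1], so that the zero combination is excluded.

In the induction, the remaining functions satisfy the hypothesis on the convex
set where the first one is negative; [convex_multiplier] then restores the
points outside that set. *)
Lemma convex_alternative (I : eqType) (G : set (Z -> R)) (f : I -> Z -> R)
    (s : seq I) (C : set Z) :
  G `<=` convex_fun ->
  (forall g h t, G g -> G h -> 0 <= t -> G (fun z => g z + t * h z)) ->
  (forall i, G (f i)) -> convex_in_cone C -> C !=set0 ->
  (forall z, C z -> exists2 i, i \in s & 0 <= f i z) ->
  exists2 g, G g & forall z, C z -> 0 <= g z.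
Proof.
move=> Gc Gcone Gf; elim: s C => [|i s ih] C cC C0 fC.
  by have [z /fC[]] := C0.
have [[b Cb fb]|Cfi] := pselect (exists2 z, C z & f i z < 0); last first.
  exists (f i) => // z Cz; rewrite leNgt; apply/negP => fz.
  by apply: Cfi; exists z.
have [|||g Gg g0] := ih (C `&` [set z | f i z < 0]).
- by apply: convex_sublevel => //; exact: Gc.
- by exists b.
- move=> z [Cz fz]; have [j + fj] := fC z Cz.
  rewrite inE => /orP[/eqP ji|js]; last by exists j.
  by move: fz => /=; rewrite ltNge -ji fj.
have [||t t0 gt] := convex_multiplier cC (Gc _ (Gf i)) (Gc _ Gg).
- by exists b.
- by move=> z Cz fz; apply: g0.
by exists (fun z => g z + t * f i z) => //; exact: Gcone.
Qed.

End Alternative.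

(** * The bipolar theorem for a bilinear map on cones *)

Section Bipolar.
Context (R : realType) (W Z : coneType R) (phi : W -> Z -> R).
Hypothesis phiDl : forall w w' z, phi (w + w') z = phi w z + phi w' z.
Hypothesis phiZl : forall (r : nneg_real R) w z,
  phi (r *: w) z = (r : R) * phi w z.
Hypothesis phiDr : forall w z z', phi w (z + z') = phi w z + phi w z'.
Hypothesis phiZr : forall (r : nneg_real R) w z,
  phi w (r *: z) = (r : R) * phi w z.

Lemma polar_conv_hull0 (A : set Z) (w : W) :
  (forall z, A z -> phi w z <= 1) <->
  (forall c, conv_hull (A `|` [set 0]) c -> phi w c <= 1).
Proof.
split=> [wA|wC z Az]; last first.
  by apply: wC; apply: sub_gen_smallest; left.
apply: (@smallest_sub _ _ _ [set c | phi w c <= 1]).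
  move=> s t x y st /=; rewrite phiDr !phiZr => wx wy.
  have stR : (s : R) + (t : R) = 1 := congr1 val st.
  by have := nneg_val_ge0 s; have := nneg_val_ge0 t; nra.
move=> z [/wA//|/= ->].
by rewrite -(scale0r (0 : Z)) phiZr mul0r.
Qed.

(** Separation: a point without approximations in [C] is cut off by a single
functional, found with [convex_alternative]. *)
Lemma bipolar_approx (C : set Z) (z : Z) : convex_in_cone C -> C 0 ->
  (forall w, (forall c, C c -> phi w c <= 1) -> phi w z <= 1) <->
  (forall (s : seq W) (e : R), 0 < e ->
    exists2 c, C c & forall w, w \in s -> phi w z - phi w c < e).
Proof.
move=> cC C0; split=> [zC s e e0|zC w wC]; last first.
  apply/ler_addgt0Pr => e e0.
  have [c Cc /(_ w)] := zC [:: w] e e0.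
  by rewrite inE eqxx => /(_ isT); have := wC c Cc; lra.
apply: contrapT => noc.
pose G := [set g | exists w (m : R),
  0 < m /\ g = fun c => phi w z - phi w c - m].
have [||||||_ [w [m [m0 ->]]] /= wC] := @convex_alternative _ _ _ G
    (fun w c => phi w z - phi w c - e) s C.
- move=> _ [w [m [_ ->]]] a b x y ab; rewrite phiDr !phiZr.
  have abR : (a : R) + (b : R) = 1 := congr1 val ab.
  have -> : (b : R) = 1 - (a : R) by rewrite -abR; ring.
  by rewrite le_eqVlt; apply/orP; left; apply/eqP; ring.
- move=> _ _ t [w [m [m0 ->]]] [w' [m' [m'0 ->]]] t0.
  have t0' : t \is Num.nneg by [].
  exists (w + NNegReal t0' *: w'), (m + t * m'); split.
    by rewrite ltr_wpDr// mulr_ge0// ltW.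
  by apply/funext => c; rewrite !phiDl !phiZl /=; ring.
- by move=> w; exists w, e.
- exact: cC.
- by exists 0.
- move=> c Cc; apply: contrapT => nw; apply: noc; exists c => // w ws.
  rewrite ltNge; apply/negP => we; apply: nw; exists w => //.
  by rewrite subr_ge0.
(* On [C] the functional [w] is at most [phi w z - m]; scaling by the inverse
   of a number strictly between this bound and [phi w z] separates at 1. *)
have phi0 : phi w 0 = 0 by rewrite -(scale0r (0 : Z)) phiZr mul0r.
have wz : m <= phi w z by have := wC 0 C0; rewrite phi0; lra.
have k0 : 0 < phi w z - m / 2 by lra.
have r0 : (phi w z - m / 2)^-1 \is Num.nneg by rewrite nnegrE invr_ge0 ltW.
have : phi (NNegReal r0 *: w) z <= 1.
  apply: zC => c Cc; rewrite phiZl /= mulrC ler_pdivrMr//.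
  by have := wC c Cc; lra.
by rewrite phiZl /= mulrC ler_pdivrMr//; lra.
Qed.

Lemma bipolar_conv_hull0 (A : set Z) (z : Z) :
  (forall w, (forall a, A a -> phi w a <= 1) -> phi w z <= 1) <->
  (forall (s : seq W) (e : R), 0 < e ->
    exists2 c, conv_hull (A `|` [set 0]) c &
      forall w, w \in s -> phi w z - phi w c < e).
Proof.
rewrite -bipolar_approx; first last.
- by apply: sub_gen_smallest; right.
- exact: convex_conv_hull.
by split=> zA w wA; apply: zA; apply/(polar_conv_hull0 A w).
Qed.

End Bipolar.

(** * Neighbourhoods and closures in the three topologies *)

Section Topologies.
Context (R : realType).

(** A ball of the base may be recentred at any of its points, so the balls
centred at [z] already form a neighbourhood basis; this makes closures
computable. *)
Lemma asym_nbhsP (Z : coneType R) (I : choiceType)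
    (q : I -> asym_seminorm Z) (z : asym_topology (range q))
    (U : set (asym_topology (range q))) :
  nbhs z U <-> exists (s : seq I) (e : R), 0 < e /\
    forall D : Z, (forall i, i \in s -> q i D < e) -> U ((z : Z) + D).
Proof.
split.
  rewrite nbhsE => -[V [[D' D'base <-] [B D'B Bz]] VU].
  have [F [x [e [Fq Ffin e0 BE]]]] := D'base _ D'B.
  move: Bz; rewrite BE => /(asym_ball_in Ffin)[e' e'0 e'e].
  have [s Fs] : exists s : seq I, F `<=` [set q i | i in [set` s]].
    move: Ffin Fq => /finite_seqP[t ->].
    elim: t => [|p t ih] tq; first by exists nil.
    have [|s ts] := ih.
      by move=> p' p't; apply: tq; rewrite /= inE p't orbT.
    have [|i _ ip] := tq p; first by rewrite /= inE eqxx.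
    exists (i :: s) => p'; rewrite /= inE => /orP[/eqP ->|/ts[j js <-]].
      by exists i => //=; rewrite inE eqxx.
    by exists j => //=; rewrite inE; apply/orP; right.
  exists s, e'; split => // D De; apply: VU; exists B => //; rewrite BE.
  apply: e'e; exists D; split => // p /Fs[i si <-]; exact: De.
move=> [s [e [e0 sU]]]; rewrite nbhsE.
exists (asym_ball [set q i | i in [set` s]] z e).
  split.
    exists [set asym_ball [set q i | i in [set` s]] z e].
      move=> _ ->; exists [set q i | i in [set` s]], z, e; split => //.
        by move=> _ [i _ <-]; exists i.
      by apply: finite_image; exact: finite_seq.
    by rewrite bigcup_set1.
  by exists 0; split => [|p _]; rewrite ?addr0// asn0.
by move=> _ [D [-> FD]]; apply: sU => i si; apply: FD; exists i.
Qed.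

Context (X : lmodType R) (Y : coneType R) (d : asym_dual_pair X Y).

Lemma pairingNl x y : d (- x) y = - d x y.
Proof. by rewrite -scaleN1r pairingZl mulN1r. Qed.

Lemma pairingBl x x' y : d (x - x') y = d x y - d x' y.
Proof. by rewrite pairingDl pairingNl. Qed.

Lemma nbhs0_sigma_XY (U : set X) :
  nbhs (0 : sigma_XY d) U <-> exists (s : seq Y) (e : R), 0 < e /\
    forall x, (forall y, y \in s -> d x y < e) -> U x.
Proof.
rewrite (asym_nbhsP (q := pairing_seminorm d)); split=> -[s [e [e0 sU]]];
  exists s, e; split => // x xs.
  rewrite -[x](add0r (x : X)); apply: sU => y ys.
  by rewrite /= gt_max xs.
rewrite [X in U X](add0r (x : X)); apply: sU => y ys.
by have := xs y ys; rewrite /= gt_max => /andP[].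
Qed.

Lemma closure_sigma_conj_XY (C : set X) (x : X) :
  closure (C : set (sigma_conj_XY d)) x <-> forall (s : seq Y) (e : R), 0 < e ->
    exists2 c, C c & forall y, y \in s -> d x y - d c y < e.
Proof.
split=> [xC s e e0|xC U].
  have [|c [Cc cx]] := xC [set c : X | forall y, y \in s -> d x y - d c y < e].
    apply/(asym_nbhsP (q := fun y => conj_seminorm (pairing_seminorm d y))).
    exists s, e; split => // D Ds y ys.
    have := Ds y ys; rewrite /= gt_max => /andP[+ _].
    by rewrite pairingNl pairingDl; lra.
  by exists c.
move=> /(asym_nbhsP (q := fun y => conj_seminorm (pairing_seminorm d y))).
move=> [s [e [e0 sU]]]; have [c Cc cx] := xC s e e0.
exists c; split => //.
have -> : c = x + (c - x) by rewrite addrC subrK.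
apply: sU => y ys; rewrite /= gt_max e0 andbT opprB pairingBl.
exact: cx.
Qed.

Lemma closure_sigma_YX (C : set Y) (y : Y) :
  closure (C : set (sigma_YX d)) y <-> forall (s : seq X) (e : R), 0 < e ->
    exists2 c, C c & forall x, x \in s -> `|d x y - d x c| < e.
Proof.
pose ev (y : Y) : {ptws X -> R} := fun x => d x y.
split=> [yC s e e0|yC U].
  have [|c [Cc cy]] :=
      yC [set c : Y | forall x, x \in s -> `|d x y - d x c| < e].
    elim: s => [|x s ih]; first exact: filterS filterT.
    have dx : (fun b : sigma_YX d => d x b) @ (y : sigma_YX d) --> d x y.
      apply: (@cvg_comp _ _ _ ev (fun g : {ptws X -> R} => g x)).
        exact: initial_continuous.
      exact: (@proj_continuous X (fun=> R) x (ev y)).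
    have /cvgrPdist_lt/(_ e e0) xe := dx.
    apply: filterS2 ih xe => c cs cx x'; rewrite inE => /orP[/eqP ->//|].
    exact: cs.
  by exists c.
rewrite nbhsE => -[_ [[V oV <-] Vy] VU].
(* Convergence of the filter generated by the basic neighbourhoods can be
   checked pointwise; this shows that they shrink into [V]. *)
pose Fil : set_system Y := filter_from [set se : seq X * R | 0 < se.2]
  (fun se => [set c | forall x, x \in se.1 -> `|d x y - d x c| < se.2]).
have FF : Filter Fil.
  apply: filter_from_filter; first by exists (nil, 1) => /=.
  move=> [s e] [t f] /= e0 f0; exists (s ++ t, Num.min e f) => /=.
    by rewrite lt_min e0.
  move=> c cst; split=> x xs; have := cst x;
    by rewrite mem_cat xs ?orbT => /(_ isT); rewrite lt_min => /andP[].
have evF : ev @ Fil --> ev y.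
  apply/cvg_sup => x; apply/cvg_image.
    by rewrite eqEsubset; split=> r // _; exists (cst r).
  have dF : d x @ Fil --> d x y.
    apply/cvgrPdist_lt => e e0; exists ([:: x], e) => //= c /(_ x).
    by rewrite inE eqxx; exact.
  move=> W /dF FW; exists (@^~ x @^-1` W) => //.
  by rewrite eqEsubset; split=> [_ [g + <-]//|r Wr]; exists (cst r).
have [[s e] /= e0 seV] := evF V (open_nbhs_nbhs (conj oV Vy)).
have [c Cc cs] := yC s e e0.
by exists c; split => //; apply: VU; exact: seV.
Qed.

End Topologies.

(** * The bipolar theorem *)

Theorem theorem3p9 (R : realType) (X : lmodType R) (Y : coneType R)
    (d : asym_dual_pair X Y) (A : set X) (B : set Y)
    (N : set (set X)) (hN : nbhs_basis (0 : sigma_XY d) N) :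
  let convA0 := conv_hull (A `|` [set 0] : set (cone_of X)) in
  let convB0 := conv_hull (B `|` [set 0]) in
  [/\ prepolar d (polar d A) = closure (convA0 : set (sigma_conj_XY d)),
      closure (convA0 : set (sigma_conj_XY d)) =
        \bigcap_(V in N) [set (v + c : X) | v in V & c in convA0]
    & polar d (prepolar d B) = closure (convB0 : set (sigma_YX d))].
Proof.
move=> convA0 convB0.
have bipA := @bipolar_conv_hull0 R Y (cone_of X) (fun y x => d (x : X) y)
  (fun y y' x => pairingDr d x y y') (fun r y x => pairingZr d r x y)
  (fun y x x' => pairingDl d x x' y) (fun r y x => pairingZl d r x y) A.
have bipB := @bipolar_conv_hull0 R (cone_of X) Y (fun x y => d (x : X) y)
  (pairingDl d) (fun r x y => pairingZl d r x y) (pairingDr d) (pairingZr d) B.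
split.
- apply/seteqP; split=> x.
    by move=> xA; apply/closure_sigma_conj_XY; exact: (bipA x).1 xA.
  by move=> /closure_sigma_conj_XY xA; exact: (bipA x).2 xA.
- apply/seteqP; split=> x.
    move=> /closure_sigma_conj_XY xA V NV.
    have /nbhs0_sigma_XY[s [e [e0 sV]]] := hN.1 V NV.
    have [c Ac cx] := xA s e e0.
    exists (x - c); last by exists c => //; rewrite subrK.
    by apply: sV => y ys; rewrite pairingBl cx.
  move=> xN; apply/closure_sigma_conj_XY => s e e0.
  have [|V NV Vs] := hN.2 [set v : X | forall y, y \in s -> d v y < e].
    by apply/nbhs0_sigma_XY; exists s, e.
  have [v Vv [c Ac <-]] := xN V NV.
  by exists c => // y ys; rewrite -pairingBl addrK Vs.
- apply/seteqP; split=> y.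
    move=> yB; apply/closure_sigma_YX => s e e0.
    (* Testing against - x as well as x turns one-sided bounds into a bound
       on the absolute value. *)
    have [c Bc cs] := (bipB y).1 yB (s ++ map -%R s) e e0.
    exists c => // x xs.
    have := cs x; rewrite mem_cat xs => /(_ isT).
    have := cs (- x); rewrite mem_cat map_f ?orbT// => /(_ isT).
    by rewrite !pairingNl ltr_norml; lra.
  move=> /closure_sigma_YX yB.
  apply/bipB => s e e0; have [c Bc cs] := yB s e e0.
  by exists c => // x /cs; exact: le_lt_trans (ler_norm _).
Qed.
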